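(* Let $q$ be a prime power, let $u>r>0$ be integers and let $a\in\mathbb{F}_q^*$. Write $s:=\gcd(u-r,q-1)$ and $d:=(q-1)/s$. Suppose that $\eta+a/\eta\in\mu_s$ for every $\eta\in\mu_{2d}$. Then $x^u+ax^r$ permutes $\mathbb{F}_q$ if and only if $-a\notin\mu_d$ and $\gcd(r,s)=1$ and $\gcd(2d,u+r)\le 2$.
   Context: For a positive integer $n$, $\mu_n$ denotes the set of all $n$-th roots of unity in a fixed algebraic closure of $\mathbb{F}_q$, i.e. all $z$ with $z^n=1$. A polynomial over $\mathbb{F}_q$ permutes $\mathbb{F}_q$ if the induced map $\mathbb{F}_q\to\mathbb{F}_q$ is a bijection. *)

(* Defs.v *)
From HB Require Import structures.
From mathcomp Require Import all_boot all_order all_algebra all_field.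

Set Implicit Arguments.
Unset Strict Implicit.
Unset Printing Implicit Defensive.

Import GRing.Theory.
Local Open Scope ring_scope.

Definition permutes (F : finFieldType) (f : {poly F}) : Prop :=
  bijective (fun x : F => f.[x]).

(* Main.v *)
Require Import Defs.
From mathcomp Require Import all_boot all_order all_algebra all_field.
From mathcomp Require Import cyclic.

Set Implicit Arguments.
Unset Strict Implicit.
Unset Printing Implicit Defensive.

Import GRing.Theory.
Local Open Scope ring_scope.

(** Over a square root t of x the binomial x^u + a x^r factors as
    t^(u+r) (eta + a/eta) with eta = t^(u-r).  If x is a nonzero element of
    the field then eta lies in mu_2d, so by hypothesis the second factor is an
    s-th root of unity, and the s-th power of the binomial is theta^(u+r) with
    theta = t^s in mu_2d ([binomial_expn_sqrt]).  Since theta^2 = x^s,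
    taking s-th powers turns the binomial f into the homomorphism
    theta^2 |-> theta^(u+r) on mu_d.

    If f x = f y with x, y nonzero, the quotient theta of the two values of
    t^s is killed by both 2d and u+r, hence by their gcd; when this gcd is at
    most 2, theta^2 = 1, that is, x^s = y^s.  Then x^u / x^r = y^u / y^r, so
    f x = f y forces x^r = y^r, and x = y because r and s are coprime
    ([binomial_injective]).

    Conversely let f be injective.  It takes the same value at all the
    gcd(r,s)-th roots of unity, so there is only one of them.  It also maps
    the set of s-th roots of unity onto itself, so f x ^ s = 1 implies
    x ^ s = 1; this says that the homomorphism above has trivial kernel:
    theta^(u+r) = 1 implies theta^2 = 1 ([sqr_eq1_of_binomial_injective]).
    Since (-1)^s = 1, the field contains enough roots of unity to deduce the
    bound on the gcd ([gcd_le2_of_binomial_injective]).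

    That -a is not in mu_d follows from the hypothesis alone: otherwise a
    square root eta of -a would be in mu_2d with eta + a/eta = 0. *)

(** * Roots of unity *)

Lemma fin_field_prim_root (F : finFieldType) (m : nat) :
  (m %| #|F|.-1)%N -> exists z : F, m.-primitive_root z.
Proof.
move=> m_dv.
have n_gt0 : (0 < #|F|.-1)%N by rewrite -subn1 subn_gt0 card_finNzRing_gt1.
pose rs := [seq x <- enum F | x != 0].
have /hasP[z _ prim_z] : has (#|F|.-1).-primitive_root rs.
  apply: has_prim_root => //.
  - apply/allP=> x; rewrite mem_filter => /andP[x_neq0 _].
    by rewrite unity_rootE -(inj_eq (mulfI x_neq0)) -exprS prednK
      ?(ltnW (card_finNzRing_gt1 F)) // expf_card mulr1.
  - by rewrite filter_uniq ?enum_uniq.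
  - by rewrite -(cardC1 (0 : F)) cardE /rs enumT.
by exists (z ^+ (#|F|.-1 %/ m)); apply: dvdn_prim_root.
Qed.

(** The powers of a primitive root already exhaust the roots of unity of order
    dividing [#|F|.-1] in any extension. *)
Lemma unity_root_in_image (F : finFieldType) (K : fieldType)
    (iota : {rmorphism F -> K}) (x : K) :
  x ^+ #|F|.-1 = 1 -> exists y : F, x = iota y.
Proof.
move=> x1; have [z prim_z] := @fin_field_prim_root F _ (dvdnn _).
have prim_iz : (#|F|.-1).-primitive_root (iota z) by rewrite fmorph_primitive_root.
by have [i ->] := prim_rootP prim_iz x1; exists (z ^+ i); rewrite rmorphXn.
Qed.

Lemma closed_field_nth_root (K : closedFieldType) (n : nat) (b : K) :
  (0 < n)%N -> exists w : K, w ^+ n = b.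
Proof.
move=> n_gt0; have /closed_rootP[w] : size ('X^n - b%:P : {poly K}) != 1%N.
  by rewrite size_XnsubC // eqSS -lt0n.
by rewrite /root !hornerE subr_eq0 => /eqP; exists w.
Qed.

Lemma unity_root_gcd (R : fieldType) (m n : nat) (x : R) :
  (0 < m)%N -> x ^+ m = 1 -> x ^+ n = 1 -> x ^+ gcdn m n = 1.
Proof.
move=> m_gt0 xm xn; have [k l eq_kl _] := egcdnP n m_gt0.
have: x ^+ (k * m) = 1 by rewrite mulnC exprM xm expr1n.
by rewrite eq_kl exprD mulnC exprM xn expr1n mul1r.
Qed.

(** * Injectivity of the binomial *)

Lemma binomial_square_factor (K : fieldType) (u r : nat) (a t : K) :
  (r <= u)%N -> t != 0 ->
  (t ^+ 2) ^+ u + a * (t ^+ 2) ^+ r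
    = t ^+ (u + r) * (t ^+ (u - r) + a / t ^+ (u - r)).
Proof.
move=> le_ru t_neq0; have td : t ^+ (u - r) != 0 by rewrite expf_neq0.
rewrite mulrDr -exprD -addnA subnKC // addnn -mul2n exprM; congr (_ + _).
have -> : (u + r = u - r + 2 * r)%N by rewrite mul2n -addnn addnA subnK.
by rewrite exprD (exprM t 2 r) [RHS]mulrC -mulrA mulKf.
Qed.

Lemma binomial_sqr_expn (K : fieldType) (u r s d : nat) (a t : K) :
  (r <= u)%N -> (s %| u - r)%N -> t ^+ (2 * (d * s)) = 1 -> t != 0 ->
  (forall eta : K, (2 * d).-unity_root eta -> s.-unity_root (eta + a / eta)) ->
  ((t ^+ 2) ^+ u + a * (t ^+ 2) ^+ r) ^+ s = (t ^+ s) ^+ (u + r).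
Proof.
move=> le_ru /dvdnP[e def_e] t1 t_neq0 hmu.
rewrite binomial_square_factor // exprMn (unity_rootP (hmu _ _)) ?mulr1.
  by rewrite exprAC.
rewrite unity_rootE -exprM def_e.
have -> : (e * s * (2 * d) = 2 * (d * s) * e)%N.
  by rewrite mulnC -!mulnA (mulnC e).
by rewrite exprM t1 expr1n.
Qed.

Section Binomial.
Variables (F : finFieldType) (K : closedFieldType) (iota : {rmorphism F -> K}).
Variables (u r s d : nat) (a : F).
Hypotheses (r_gt0 : (0 < r)%N) (lt_ru : (r < u)%N).
Hypotheses (s_dv : (s %| u - r)%N) (def_ds : (d * s = #|F|.-1)%N).
Hypothesis hmu : forall eta : K,
  (2 * d).-unity_root eta -> s.-unity_root (eta + iota a / eta).

Let f (x : F) : F := x ^+ u + a * x ^+ r.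

Let N_gt0 : (0 < #|F|.-1)%N.
Proof. by rewrite -subn1 subn_gt0 card_finNzRing_gt1. Qed.

Let s_gt0 : (0 < s)%N.
Proof. by move: N_gt0; rewrite -def_ds muln_gt0 => /andP[]. Qed.

Let d_gt0 : (0 < d)%N.
Proof. by move: N_gt0; rewrite -def_ds muln_gt0 => /andP[]. Qed.

Let f0 : f 0 = 0.
Proof. by rewrite /f !expr0n !gtn_eqF ?mulr0 ?addr0 // (leq_ltn_trans _ lt_ru). Qed.

Lemma expf_card_unit (x : F) : x != 0 -> x ^+ (d * s) = 1.
Proof.
move=> x_neq0; apply: (mulfI x_neq0).
by rewrite def_ds -exprS prednK ?expf_card ?mulr1 // (ltnW (card_finNzRing_gt1 F)).
Qed.

(** The square root is taken in the extension because it need not exist in the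
    base field; its order still divides twice that of the unit group. *)
Lemma nonzero_sqrt (x : F) : x != 0 ->
  exists t : K, [/\ t ^+ 2 = iota x, t != 0 & t ^+ (2 * (d * s)) = 1].
Proof.
move=> x_neq0; have [t t2] := @closed_field_nth_root K 2 (iota x) isT.
exists t; split=> //.
  by apply: contraNneq x_neq0 => t0; rewrite -(fmorph_eq0 iota) -t2 t0 expr0n.
by rewrite exprM t2 -rmorphXn expf_card_unit // rmorph1.
Qed.

(** The key identity: the s-th power kills the factor eta + a/eta, and leaves
    a monomial in t^s. *)
Lemma binomial_expn_sqrt (x : F) (t : K) :
  t ^+ 2 = iota x -> t != 0 -> t ^+ (2 * (d * s)) = 1 ->
  iota (f x) ^+ s = (t ^+ s) ^+ (u + r).
Proof.
move=> t2 t_neq0 t1.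
by rewrite /f rmorphD rmorphM !rmorphXn -t2 (@binomial_sqr_expn _ _ _ _ d) // ltnW.
Qed.

(** By the key identity, the s-th power of the value is a power of t. *)
Lemma binomial_neq0 (x : F) : x != 0 -> f x != 0.
Proof.
move=> x_neq0; have [t [t2 t_neq0 t1]] := nonzero_sqrt x_neq0.
rewrite -(fmorph_eq0 iota); apply: contraNneq (t_neq0) => fx0.
have := binomial_expn_sqrt t2 t_neq0 t1.
rewrite fx0 expr0n gtn_eqF // => /esym/eqP.
by rewrite mulr0n !expf_eq0 => /andP[_ /andP[_]].
Qed.

Lemma opp_not_unity_root : ~~ d.-unity_root (iota (- a)).
Proof.
apply/negP => /unity_rootP a1.
have [eta eta2] := @closed_field_nth_root K 2 (iota (- a)) isT.
have eta1 : (2 * d).-unity_root eta by rewrite unity_rootE exprM eta2 a1.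
have eta_neq0 : eta != 0.
  apply: contraTneq eta1 => ->.
  by rewrite unity_rootE expr0n gtn_eqF ?muln_gt0 // eq_sym oner_eq0.
have := hmu eta1.
have -> : eta + iota a / eta = 0.
  apply: (mulIf eta_neq0).
  by rewrite mulrDl divfK // -expr2 eta2 rmorphN addNr mul0r.
by rewrite unity_rootE expr0n gtn_eqF // eq_sym oner_eq0.
Qed.

Lemma binomial_injective :
  coprime r s -> (gcdn (2 * d) (u + r) <= 2)%N -> injective f.
Proof.
move=> co_rs le_g x y.
have [-> | x_neq0] := eqVneq x 0.
  rewrite f0 => fy0; apply/esym/eqP.
  by apply: contraTT (eqxx (f y)) => /binomial_neq0; rewrite -fy0 eqxx.
have [-> | y_neq0] := eqVneq y 0.
  by rewrite f0 => fx0; have := binomial_neq0 x_neq0; rewrite fx0 eqxx.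
move=> eq_f.
have [t [t2 t_neq0 t1]] := nonzero_sqrt x_neq0.
have [v [v2 v_neq0 v1]] := nonzero_sqrt y_neq0.
pose th := (t / v) ^+ s.
have th_ur : th ^+ (u + r) = 1.
  rewrite /th !expr_div_n -(binomial_expn_sqrt t2) // -(binomial_expn_sqrt v2) //.
  rewrite eq_f divff //.
  by rewrite expf_neq0 // fmorph_eq0 binomial_neq0.
have th_2d : th ^+ (2 * d) = 1.
  by rewrite /th -exprM mulnC -mulnA expr_div_n t1 v1 divr1.
have th2 : th ^+ 2 = 1.
  have d2_gt0 : (0 < 2 * d)%N by rewrite muln_gt0.
  have := unity_root_gcd d2_gt0 th_2d th_ur.
  have : (0 < gcdn (2 * d) (u + r))%N by rewrite gcdn_gt0 d2_gt0.
  by case: gcdn le_g => [|[|[|]]] // _ _; rewrite ?expr1 // => ->; rewrite expr1n.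
have [z def_x zs] : exists2 z, x = z * y & z ^+ s = 1.
  exists (x / y); first by rewrite divfK.
  apply: (fmorph_inj iota); rewrite rmorph1 rmorphXn fmorph_div -t2 -v2.
  by rewrite -expr_div_n exprAC.
have zr : z ^+ r = 1.
  have zu : z ^+ u = z ^+ r.
    have /dvdnP[e def_e] := s_dv.
    by rewrite -(subnK (ltnW lt_ru)) exprD def_e mulnC exprM zs expr1n mul1r.
  apply: (mulIf (binomial_neq0 y_neq0)); rewrite mul1r -[RHS]eq_f def_x /f !exprMn zu.
  by rewrite mulrDr mulrCA.
by have := unity_root_gcd r_gt0 zr zs;
  rewrite (eqP co_rs) expr1 def_x => ->; rewrite mul1r.
Qed.

(** Both exponents are multiples of gcd(r,s), so a primitive root of that order
    and 1 have the same image. *)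
Lemma coprime_of_binomial_injective : injective f -> coprime r s.
Proof.
move=> inj_f.
have c_dv : (gcdn r s %| #|F|.-1)%N.
  by rewrite -def_ds dvdn_mull // dvdn_gcdr.
have [z prim_z] := fin_field_prim_root c_dv.
have zr : z ^+ r = 1.
  by apply/eqP; rewrite -(prim_order_dvd prim_z) dvdn_gcdl.
have zu : z ^+ u = 1.
  apply/eqP; rewrite -(prim_order_dvd prim_z) -(subnK (ltnW lt_ru)).
  by rewrite dvdn_add ?dvdn_gcdl // (dvdn_trans (dvdn_gcdr _ _)).
have z1 : z = 1 by apply: inj_f; rewrite /f zu zr !expr1n.
by rewrite /coprime -dvdn1 (prim_order_dvd prim_z) expr1 z1.
Qed.

(** The hypothesis at eta = 1; at eta = -1 it gives [expn_opp1]. *)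
Lemma expn_1Da : (1 + a) ^+ s = 1.
Proof.
apply: (fmorph_inj iota); rewrite rmorphXn rmorphD !rmorph1.
have /hmu /unity_rootP : (2 * d).-unity_root (1 : K).
  by rewrite unity_rootE expr1n.
by rewrite divr1.
Qed.

(** On the s-th roots of unity y the binomial is (1 + a) y^r, again such a
    root.  An injective self-map of this finite set is onto, so by global
    injectivity nothing outside the set is sent into it. *)
Lemma binomial_preim_unity_root (x : F) :
  injective f -> f x ^+ s = 1 -> x ^+ s = 1.
Proof.
move=> inj_f fx1.
pose S := [set y : F | y ^+ s == 1].
have f_S : f @: S = S.
  apply/eqP; rewrite eqEcard card_imset // leqnn andbT.
  apply/subsetP => _ /imsetP[y ys ->]; move: ys; rewrite !inE => /eqP ys.
  have /dvdnP[e def_e] := s_dv.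
  rewrite /f -(subnK (ltnW lt_ru)) exprD def_e mulnC exprM ys expr1n mul1r.
  rewrite -[X in X + _]mul1r -mulrDl exprMn expn_1Da mul1r exprAC ys.
  by rewrite expr1n.
have : f x \in f @: S by rewrite f_S inE fx1.
by rewrite mem_imset // inE => /eqP.
Qed.

(** Writing theta = w^s, the element x = w^2 lies in F because
    w^(2ds) = theta^(2d) = 1.  Then f x ^ s = theta^(u+r) = 1, so theta^2 = x^s
    is 1 by the previous lemma. *)
Lemma sqr_eq1_of_binomial_injective (th : F) : injective f ->
  th ^+ (2 * d) = 1 -> th ^+ (u + r) = 1 -> th ^+ 2 = 1.
Proof.
move=> inj_f th_2d th_ur.
have [w ws] := @closed_field_nth_root K s (iota th) s_gt0.
have w1 : w ^+ (2 * (d * s)) = 1.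
  by rewrite mulnA mulnC exprM ws -rmorphXn th_2d rmorph1.
have w_neq0 : w != 0.
  apply: contra_eq_neq w1 => ->.
  by rewrite expr0n gtn_eqF ?muln_gt0 ?d_gt0 // eq_sym oner_eq0.
have [x def_x] : exists x : F, w ^+ 2 = iota x.
  by apply: unity_root_in_image; rewrite -def_ds -exprM.
have fx1 : f x ^+ s = 1.
  apply: (fmorph_inj iota); rewrite rmorph1 rmorphXn (binomial_expn_sqrt def_x) //.
  by rewrite ws -rmorphXn th_ur rmorph1.
apply: (fmorph_inj iota); rewrite rmorph1 rmorphXn -ws exprAC def_x -rmorphXn.
by rewrite binomial_preim_unity_root // rmorph1.
Qed.

Lemma expn_opp1 : (-1) ^+ s = 1 :> F.
Proof.
apply: (fmorph_inj iota); rewrite rmorphXn rmorphN !rmorph1.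
have /hmu /unity_rootP : (2 * d).-unity_root (- 1 : K).
  by rewrite unity_rootE exprM sqrrN !expr1n.
have -> : -1 + iota a / -1 = -1 * iota (1 + a).
  by rewrite invrN1 mulrN1 rmorphD rmorph1 mulN1r opprD.
by rewrite exprMn -rmorphXn expn_1Da rmorph1 mulr1.
Qed.

(** It suffices to produce in F a primitive root z of the right order, since
    z^2 = 1 bounds that order.  If s is even, 2d divides ds and a root of order
    gcd(2d,u+r) exists in F.  If s is odd, then (-1)^s = 1 means that the
    characteristic is 2; a root of order gcd(d,u+r) exists, it is 1 because
    its square is, and gcd(2d,u+r) divides 2 gcd(d,u+r). *)
Lemma gcd_le2_of_binomial_injective : injective f -> (gcdn (2 * d) (u + r) <= 2)%N.
Proof.
move=> inj_f; apply: dvdn_leq => //.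
have ker (m : nat) (z : F) : m.-primitive_root z ->
    (m %| 2 * d)%N -> (m %| u + r)%N -> z ^+ 2 = 1.
  move=> prim_z; rewrite !(prim_order_dvd prim_z) => /eqP z1 /eqP z2.
  exact: sqr_eq1_of_binomial_injective.
have [odd_s | even_s] := boolP (odd s).
  have opp1 : -1 = 1 :> F by have := expn_opp1; rewrite -signr_odd odd_s expr1.
  have h_dv : (gcdn d (u + r) %| #|F|.-1)%N.
    by rewrite -def_ds dvdn_mulr // dvdn_gcdl.
  have [z prim_z] := fin_field_prim_root h_dv.
  (* In characteristic 2, z^2 = 1 gives z = 1. *)
  have /eqP := ker _ z prim_z (dvdn_mull _ (dvdn_gcdl _ _)) (dvdn_gcdr _ _).
  rewrite sqrf_eq1 opp1 orbb -{1}(expr1 z) -(prim_order_dvd prim_z) dvdn1 => /eqP h1.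
  rewrite -[X in (_ %| X)%N]muln1 -h1 muln_gcdr dvdn_gcd dvdn_gcdl.
  by rewrite (dvdn_trans (dvdn_gcdr _ _)) // dvdn_mull.
have g_dv : (gcdn (2 * d) (u + r) %| #|F|.-1)%N.
  rewrite -def_ds; apply: dvdn_trans (dvdn_gcdl _ _) _.
  by rewrite mulnC dvdn_pmul2l // dvdn2.
have [z prim_z] := fin_field_prim_root g_dv.
by rewrite (prim_order_dvd prim_z) (ker _ z prim_z) ?dvdn_gcdl ?dvdn_gcdr.
Qed.

End Binomial.

Theorem theorem1p1 (q : nat) (Fq : finFieldType) (hq : #|Fq| = q)
    (K : closedFieldType) (iota : {rmorphism Fq -> K})
    (halg : integralRange iota)
    (u r : nat) (hr : (0 < r)%N) (hu : (r < u)%N)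
    (a : Fq) (ha : a != 0)
    (s d : nat) (hs : s = gcdn (u - r) (q - 1)) (hd : d = ((q - 1) %/ s)%N)
    (hmu : forall eta : K, (2 * d).-unity_root eta ->
             s.-unity_root (eta + iota a / eta)) :
  permutes ('X^u + a *: 'X^r) <->
    [/\ ~~ d.-unity_root (iota (- a)), gcdn r s = 1%N
      & (gcdn (2 * d) (u + r) <= 2)%N].
Proof.
have s_dv : (s %| u - r)%N by rewrite hs dvdn_gcdl.
have def_ds : (d * s = #|Fq|.-1)%N by rewrite hd hq -subn1 divnK // hs dvdn_gcdr.
have fE (x : Fq) : ('X^u + a *: 'X^r).[x] = x ^+ u + a * x ^+ r by rewrite !hornerE.
split=> [/bij_inj inj_p | [_ co_rs le_g]].
  have inj_f : injective (fun x : Fq => x ^+ u + a * x ^+ r).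
    by move=> x y; rewrite -!fE => /inj_p.
  split; first exact: opp_not_unity_root def_ds hmu.
    exact/eqP/(coprime_of_binomial_injective hu s_dv def_ds inj_f).
  exact: (gcd_le2_of_binomial_injective hu s_dv def_ds hmu inj_f).
apply: injF_bij => x y; rewrite !fE.
by apply: (binomial_injective hr hu s_dv def_ds hmu) => //; apply/eqP.
Qed.
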